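(* Let $\widetilde{\mathrm{tol}}>0$ be a given Greedy tolerance. Assume that for some function $C:\mathcal D\to(0,\infty)$ the following relation holds for the snapshot parameters $\mu^i$ selected by the algorithm AdaptGreedy: for every $n$ reached by the algorithm and every $\mu^i\in S_n=\{\mu^1,\dots,\mu^n\}$, $$\overline\Delta_n^{\varepsilon}(\mu^i)\le C(\mu^i)\,\mathbb E\big(u(\mu^i),\zeta_i^{\varepsilon}\big),\qquad \zeta_i^{\varepsilon}:=u^{\varepsilon}(\mu^i).$$ Let the snapshot tolerances be chosen as $$\varepsilon(\mu):=\widetilde{\mathrm{tol}}\,\frac{c_\Delta}{C(\mu)} .$$ Then: if AdaptGreedy terminates through its stopping criterion with some $N<N_{\max}$ (i.e. it returns $X_N^\varepsilon$), we have $$\max_{\mu\in\mathcal D_{\mathrm{train}}}\|e_N^{\varepsilon}(\mu)\|_{\mathcal X}<\widetilde{\mathrm{tol}} .$$ In particular, if multiple selection of snapshots occurs, i.e. if $\mu^{n+1}\in S_n$ for some $n$, then $\overline\Delta_n^{\varepsilon}(\mu^{n+1})< c_\Delta\,\widetilde{\mathrm{tol}}$, and AdaptGreedy terminates through its stopping criterion, ensuring $\max_{\mu\in\mathcal D_{\mathrm{train}}}\|e_n^{\varepsilon}(\mu)\|_{\mathcal X}<\widetilde{\mathrm{tol}}$.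
   Context: Setting. $\mathcal X,\mathcal Y$ are real Hilbert spaces with duals $\mathcal X',\mathcal Y'$; $\mathcal D\subset\mathbb R^P$ is a set of parameters and $\mathcal D_{\mathrm{train}}\subset\mathcal D$ is a finite training set. For each $\mu\in\mathcal D$, $\mathcal B(\mu):\mathcal X\to\mathcal Y'$ is a bounded linear operator with associated bilinear form $b(w,v;\mu)=\langle\mathcal B(\mu)w,v\rangle_{\mathcal Y'\times\mathcal Y}$, satisfying $b(w,v;\mu)\le\gamma(\mu)\|w\|_{\mathcal X}\|v\|_{\mathcal Y}$ with $\gamma(\mu)\le\gamma^{UB}<\infty$, and the Nečas condition $$\beta(\mu)=\inf_{w\in\mathcal X}\sup_{v\in\mathcal Y}\frac{b(w,v;\mu)}{\|w\|_{\mathcal X}\|v\|_{\mathcal Y}}=\inf_{v\in\mathcal Y}\sup_{w\in\mathcal X}\frac{b(w,v;\mu)}{\|w\|_{\mathcal X}\|v\|_{\mathcal Y}}\ge\beta_{LB}>0$$ (nonzero elements). For $f(\mu)\in\mathcal Y'$, $u(\mu)\in\mathcal X$ is the unique solution of $\mathcal B(\mu)u(\mu)=f(\mu)$. Snapshots. $\mathbb E:\mathcal X\times\mathcal X\to[0,\infty)$ is an error measure (it may depend on $\mu$ when evaluated at the parameter $\mu$). A snapshot for $\mu$ is an element $u^\varepsilon(\mu)\in\mathcal X$ with $\mathbb E(u(\mu),u^\varepsilon(\mu))\le\varepsilon(\mu)$, where $\varepsilon(\mu)>0$ is a prescribed tolerance. Reduced basis (RB) approximation. For parameters $\mu^1,\dots,\mu^n$,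 let $S_n=\{\mu^1,\dots,\mu^n\}$ and $X_n^\varepsilon=\mathrm{span}\{u^\varepsilon(\mu^i):1\le i\le n\}$ ($X_0^\varepsilon=\{0\}$). With a test space $Y_n^\varepsilon(\mu)\subset\mathcal Y$ (possibly $\mu$-dependent) such that $b(\cdot,\cdot;\mu)$ is inf-sup stable on $X_n^\varepsilon\times Y_n^\varepsilon(\mu)$ and $\dim Y_n^\varepsilon(\mu)=\dim X_n^\varepsilon$, $u_n^\varepsilon(\mu)\in X_n^\varepsilon$ is the solution of $b(u_n^\varepsilon(\mu),v;\mu)=\langle f(\mu),v\rangle_{\mathcal Y'\times\mathcal Y}$ for all $v\in Y_n^\varepsilon(\mu)$. The error is $e_n^\varepsilon(\mu):=u(\mu)-u_n^\varepsilon(\mu)$. Error estimators. $\Delta_n^\varepsilon(\mu):=\|f(\mu)-\mathcal B(\mu)u_n^\varepsilon(\mu)\|_{\mathcal Y'}/\beta(\mu)$. A surrogate $\overline\Delta_n^\varepsilon(\mu)$ is assumed to be available with constants $0<c_\Delta\le C_\Delta$ such that $c_\Delta\Delta_n^\varepsilon(\mu)\le\overline\Delta_n^\varepsilon(\mu)\le C_\Delta\Delta_n^\varepsilon(\mu)$ for all $\mu\in\mathcal D$ and all $n$. Algorithm AdaptGreedy (inputs $\widetilde{\mathrm{tol}}$, $N_{\max}$, $\varepsilon(\cdot)$, $\mathcal D_{\mathrm{train}}$). Start with $S_0=\emptyset$. For $n=0,1,\dots,N_{\max}-1$: choose $\mu^{n+1}\in\arg\max_{\mu\in\mathcal D_{\mathrm{train}}}\overline\Delta_n^\varepsilon(\mu)$;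 if $\overline\Delta_n^\varepsilon(\mu^{n+1})<c_\Delta\,\widetilde{\mathrm{tol}}$ (stopping criterion), return $X_n^\varepsilon$; otherwise set $S_{n+1}=S_n\cup\{\mu^{n+1}\}$, compute a snapshot $u^\varepsilon(\mu^{n+1})$ and set $X_{n+1}^\varepsilon=X_n^\varepsilon+\mathrm{span}\{u^\varepsilon(\mu^{n+1})\}$. ''Terminates with $N<N_{\max}$'' means that the stopping criterion is met and $X_N^\varepsilon$ is returned.
   Formalization: For multiple selection, the strict bounds and termination are proved only if the re-selected snapshot meets its tolerance strictly, E(u,u^ε)<ε; with equality they can fail. Without this only the non-strict bounds (estimator ≤ c_Δ·tol, maximal error ≤ tol) are proved. *)

(* Defs.v *)
From HB Require Import structures.
From mathcomp Require Import all_boot all_order all_algebra finmap.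
From mathcomp Require Import all_classical all_reals all_analysis.

Set Implicit Arguments.
Unset Strict Implicit.
Unset Printing Implicit Defensive.

Import Order.TTheory GRing.Theory Num.Theory.
Import numFieldNormedType.Exports.

Local Open Scope classical_set_scope.
Local Open Scope ring_scope.

(* Together with completeness of V, this makes V a real Hilbert space. *)
Definition hilbert_norm (R : realType) (V : normedModType R)
    (ip : {dot V for idfun}) : Prop :=
  forall x : V, `|x| ^+ 2 = ip x x.

(* Everything below that is attached to one parameter value takes the operator
   B : X -> Y' in curried form, i.e. as b w v = <B w, v>. *)

(* Extended-real valued; the infimum over no element is +oo. *)
Definition infsup (R : realType) (X Y : normedModType R) (b : X -> Y -> R)
    (A : set X) (A' : set Y) : \bar R :=
  ereal_inf [set ereal_sup [set (b w v / (`|w| * `|v|))%:E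
                           | v in A' `\ (0 : Y)]
            | w in A `\ (0 : X)].

(* Finite as soon as X is not {0}. If X = {0} then it is 0, and since the
   residual is then 0 too, [residual_estimator] is 0 as expected. *)
Definition necas_constant (R : realType) (X Y : normedModType R)
    (b : X -> Y -> R) : R :=
  fine (infsup b setT setT).

Definition necas_condition (R : realType) (X Y : normedModType R)
    (b : X -> Y -> R) (betaLB : R) : Prop :=
  infsup b setT setT = infsup (fun v w => b w v) setT setT /\
  (betaLB%:E <= infsup b setT setT)%E.

Definition dual_norm (R : realType) (Y : normedModType R) (g : Y -> R) : R :=
  sup [set `|g v| / `|v| | v in [set v : Y | v != 0]].

Definition residual_estimator (R : realType) (X Y : normedModType R)
    (b : X -> Y -> R) (f : Y -> R) (un : X) : R :=
  dual_norm (fun v => f v - b un v) / necas_constant b.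

Definition lin_span (R : realType) (V : lmodType R) (n : nat) (e : 'I_n -> V)
    : set V :=
  range (fun a : 'I_n -> R => \sum_(i < n) a i *: e i).

Definition lin_indep (R : realType) (V : lmodType R) (n : nat) (e : 'I_n -> V)
    : Prop :=
  forall a : 'I_n -> R, \sum_(i < n) a i *: e i = 0 -> forall i, a i = 0.

(* A is a linear subspace of finite dimension n. *)
Definition has_dim (R : realType) (V : lmodType R) (A : set V) (n : nat)
    : Prop :=
  exists2 e : 'I_n -> V, lin_indep e & A = lin_span e.

Record rb_solution (R : realType) (X Y : normedModType R) (b : X -> Y -> R)
    (f : Y -> R) (Xn : set X) (Yn : set Y) (un : X) : Prop := RBSolution {
  rb_same_dim : exists2 k, has_dim Xn k & has_dim Yn k;
  rb_stable : (0 < infsup b Xn Yn)%E;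
  rb_in_space : Xn un;
  rb_galerkin : forall v, Yn v -> b un v = f v
}.

(* A run of the greedy algorithm is recorded by sel : nat -> T, where sel n is
   the parameter chosen in iteration n, i.e. sel n = mu^(n+1) and
   S_n = {sel 0, ..., sel n.-1}. Values of sel, est, ... at iterations that
   are not reached are irrelevant. Here est n mu is the estimator evaluated in
   iteration n, and thr the threshold of the stopping criterion. *)

Definition selected (T : Type) (sel : nat -> T) (n : nat) : set T :=
  sel @` `I_n.

Definition rb_space (R : realType) (V : lmodType R) (T : Type)
    (snap : T -> V) (sel : nat -> T) (n : nat) : set V :=
  lin_span (fun i : 'I_n => snap (sel i)).

Definition greedy_stop (R : realType) (T : Type) (est : nat -> T -> R)
    (thr : R) (sel : nat -> T) (n : nat) : Prop :=
  est n (sel n) < thr.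

Definition greedy_reached (R : realType) (T : Type) (est : nat -> T -> R)
    (thr : R) (Nmax : nat) (sel : nat -> T) (n : nat) : Prop :=
  (n < Nmax)%N /\ forall m, (m < n)%N -> ~ greedy_stop est thr sel m.

Definition greedy_run (R : realType) (T : choiceType) (train : {fset T})
    (est : nat -> T -> R) (thr : R) (Nmax : nat) (sel : nat -> T) : Prop :=
  forall n, greedy_reached est thr Nmax sel n ->
    sel n \in train /\ forall mu, mu \in train -> est n mu <= est n (sel n).

Definition greedy_terminates (R : realType) (T : Type) (est : nat -> T -> R)
    (thr : R) (Nmax : nat) (sel : nat -> T) (N : nat) : Prop :=
  greedy_reached est thr Nmax sel N /\ greedy_stop est thr sel N.

(* The values g mu are norms, so the neutral element 0 is harmless. *)
Definition max_on (R : realType) (T : choiceType) (A : {fset T}) (g : T -> R)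
    : R :=
  \big[Num.max/0]_(mu <- A) g mu.

(* Main.v *)
Require Import Defs.
From HB Require Import structures.
From mathcomp Require Import all_boot all_order all_algebra finmap.
From mathcomp Require Import all_classical all_reals all_analysis.

Set Implicit Arguments.
Unset Strict Implicit.
Unset Printing Implicit Defensive.

Import Order.TTheory GRing.Theory Num.Theory.
Import numFieldNormedType.Exports.

Local Open Scope classical_set_scope.
Local Open Scope ring_scope.

(* The residual of [un] is [v |-> b (u - un) v], so the inf-sup condition bounds
   the error by the residual estimator; the surrogate estimator bounds the
   latter on the whole training set by its maximum, reached at the parameter
   selected next. At a parameter [mu] selected before, the surrogate is at most
   [C mu * eps mu = cD * tol]. *)

Lemma dual_norm_ge0 (R : realType) (Y : normedModType R) (g : Y -> R) :
  0 <= dual_norm g.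
Proof.
rewrite /dual_norm; set A := [set _ | _ in _].
have A0 : lbound A 0 by move=> _ [v _ <-]; rewrite divr_ge0.
have [->|/set0P neA] := eqVneq A set0; first by rewrite sup0.
have [ubA|nubA] := pselect (has_ubound A); last first.
  by rewrite sup_out // => -[].
by have [x Ax] := neA; rewrite (le_trans (A0 x Ax))// ub_le_sup.
Qed.

Lemma infsup_le (R : realType) (X Y : normedModType R) (b : X -> Y -> R)
    (w : X) (c : R) : w != 0 ->
  (forall v, v != 0 -> b w v / (`|w| * `|v|) <= c) ->
  (infsup b setT setT <= c%:E)%E.
Proof.
move=> w0 bc; apply: (@le_trans _ _
    (ereal_sup [set (b w v / (`|w| * `|v|))%:E | v in setT `\ (0 : Y)])).
  by apply: ereal_inf_lbound; exists w => //; split => //; exact/eqP.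
by apply: ge_ereal_sup => _ [v [_ /eqP v0] <-]; rewrite lee_fin bc.
Qed.

Lemma error_le_residual_estimator (R : realType) (X Y : normedModType R)
    (b : {bilinear X -> Y -> R | *%R & *%R}) (f : Y -> R) (gamma betaLB : R)
    (u un : X) :
  (forall w v, b w v <= gamma * `|w| * `|v|) ->
  0 < betaLB -> (betaLB%:E <= infsup b setT setT)%E ->
  (forall v, b u v = f v) ->
  `|u - un| <= residual_estimator b f un.
Proof.
move=> b_le betaLB0 beta_ge bu.
have [<-|] := eqVneq u un.
  rewrite subrr normr0 divr_ge0 ?dual_norm_ge0// fine_ge0//.
  by rewrite (le_trans _ beta_ge)// lee_fin ltW.
rewrite -subr_eq0 /residual_estimator; set w := u - un => w0.
have nw0 : 0 < `|w| by rewrite normr_gt0.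
have -> : (fun v => f v - b un v) = b w.
  by apply/funext => v; rewrite /w linearBl bu.
have le_dual v : v != 0 -> `|b w v| / `|v| <= dual_norm (b w).
  move=> v0; apply: ub_le_sup; last by exists v.
  exists (gamma * `|w|) => _ [z /= z0 <-].
  rewrite ler_pdivrMr ?normr_gt0// ler_norml b_le andbT lerNl.
  by rewrite -(normrN z) -linearNr b_le.
have beta_le : (infsup b setT setT <= (dual_norm (b w) / `|w|)%:E)%E.
  apply: (infsup_le w0) => v v0.
  rewrite invfM mulrCA mulrC ler_pM2r ?invr_gt0//.
  by rewrite (le_trans _ (le_dual v v0))// ler_wpM2r ?invr_ge0// ler_norm.
move: beta_ge beta_le; rewrite /necas_constant.
case: (infsup b setT setT) => [beta| |] //=; rewrite !lee_fin => beta_ge.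
have beta0 : 0 < beta by exact: lt_le_trans beta_ge.
by rewrite !ler_pdivlMr// mulrC.
Qed.

Lemma max_on_le (R : realType) (T : choiceType) (A : {fset T}) (g : T -> R)
    (c : R) :
  0 <= c -> (forall x, x \in A -> g x <= c) -> max_on A g <= c.
Proof. by move=> c0 gc; rewrite /max_on big_seq; exact: bigmax_le. Qed.

Lemma max_on_lt (R : realType) (T : choiceType) (A : {fset T}) (g : T -> R)
    (c : R) :
  0 < c -> (forall x, x \in A -> g x < c) -> max_on A g < c.
Proof. by move=> c0 gc; rewrite /max_on big_seq; exact: bigmax_lt. Qed.

Theorem proposition3p3
  (R : realType)
  (X Y : completeNormedModType R)
  (ipX : {dot X for idfun}) (ipY : {dot Y for idfun})
  (hX : hilbert_norm ipX) (hY : hilbert_norm ipY)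
  (P : nat) (D : set 'rV[R]_P) (Dtrain : {fset 'rV[R]_P})
  (hDtrain : forall mu, mu \in Dtrain -> D mu)
  (* the parametric problem *)
  (b : 'rV[R]_P -> {bilinear X -> Y -> R | *%R & *%R})
  (gamma : 'rV[R]_P -> R) (gammaUB betaLB : R)
  (hb : forall mu, D mu -> forall w v, b mu w v <= gamma mu * `|w| * `|v|)
  (hgamma : forall mu, D mu -> gamma mu <= gammaUB)
  (hbetaLB : 0 < betaLB)
  (hbeta : forall mu, D mu -> necas_condition (b mu) betaLB)
  (f : 'rV[R]_P -> {linear Y -> R^o})
  (hf : forall mu, D mu -> continuous (f mu))
  (u : 'rV[R]_P -> X)
  (hu : forall mu, D mu -> forall v, b mu (u mu) v = f mu v)
  (* error measure, tolerances, constants *)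
  (E : 'rV[R]_P -> X -> X -> R)
  (hE : forall mu, D mu -> forall w w', 0 <= E mu w w')
  (tol : R) (htol : 0 < tol) (Nmax : nat)
  (cD CD : R) (hcD : 0 < cD) (hCD : cD <= CD)
  (C : 'rV[R]_P -> R) (hC : forall mu, D mu -> 0 < C mu)
  (eps : 'rV[R]_P -> R)
  (heps : forall mu, D mu -> eps mu = tol * (cD / C mu))
  (* a run of AdaptGreedy *)
  (ueps : 'rV[R]_P -> X)
  (Yn : nat -> 'rV[R]_P -> set Y)
  (un : nat -> 'rV[R]_P -> X)
  (Dbar : nat -> 'rV[R]_P -> R)
  (sel : nat -> 'rV[R]_P)
  (hrun : greedy_run Dtrain Dbar (cD * tol) Nmax sel)
  (hsnap : forall n mu, greedy_reached Dbar (cD * tol) Nmax sel n ->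
     selected sel n mu -> E mu (u mu) (ueps mu) <= eps mu)
  (hun : forall n mu, greedy_reached Dbar (cD * tol) Nmax sel n -> D mu ->
     rb_solution (b mu) (f mu) (rb_space ueps sel n) (Yn n mu) (un n mu))
  (hDbar : forall n mu, greedy_reached Dbar (cD * tol) Nmax sel n -> D mu ->
     cD * residual_estimator (b mu) (f mu) (un n mu) <= Dbar n mu
       <= CD * residual_estimator (b mu) (f mu) (un n mu))
  (hrel : forall n mu, greedy_reached Dbar (cD * tol) Nmax sel n ->
     selected sel n mu -> Dbar n mu <= C mu * E mu (u mu) (ueps mu)) :
  (forall N, greedy_terminates Dbar (cD * tol) Nmax sel N ->
     max_on Dtrain (fun mu => `|u mu - un N mu|) < tol)
  /\
  (forall n, greedy_reached Dbar (cD * tol) Nmax sel n ->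
     selected sel n (sel n) ->
     (Dbar n (sel n) <= cD * tol /\
      max_on Dtrain (fun mu => `|u mu - un n mu|) <= tol)
     /\
     (* The strict claims fail if the snapshot only meets its tolerance with
        equality. *)
     (E (sel n) (u (sel n)) (ueps (sel n)) < eps (sel n) ->
      [/\ Dbar n (sel n) < cD * tol,
          greedy_terminates Dbar (cD * tol) Nmax sel n
        & max_on Dtrain (fun mu => `|u mu - un n mu|) < tol])).
Proof.
have err n mu : greedy_reached Dbar (cD * tol) Nmax sel n -> mu \in Dtrain ->
    cD * `|u mu - un n mu| <= Dbar n (sel n).
  move=> rn mut; have Dmu := hDtrain mu mut.
  have [_ /(_ mu mut)] := hrun n rn; apply: le_trans.
  have /andP[+ _] := hDbar n mu rn Dmu; apply: le_trans.
  rewrite ler_pM2l//; have [_ bge] := hbeta mu Dmu.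
  exact: error_le_residual_estimator (hb mu Dmu) hbetaLB bge (hu mu Dmu).
have strict n : greedy_terminates Dbar (cD * tol) Nmax sel n ->
    max_on Dtrain (fun mu => `|u mu - un n mu|) < tol.
  move=> [rn sn]; apply: max_on_lt => // mu mut.
  by rewrite -(ltr_pM2l hcD) (le_lt_trans (err n mu rn mut)).
split=> // n rn seln; have [/hDtrain Dsel _] := hrun n rn.
have C0 := hC _ Dsel.
have Ceps : C (sel n) * eps (sel n) = cD * tol.
  by rewrite heps// mulrCA (mulrC (C _)) divfK ?gt_eqF// mulrC.
have relE := hrel n _ rn seln.
have le_tol : Dbar n (sel n) <= cD * tol.
  by rewrite (le_trans relE)// -Ceps ler_pM2l// (hsnap n).
split; first split=> //.
  apply: max_on_le => [|mu mut]; first exact: ltW.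
  by rewrite -(ler_pM2l hcD) (le_trans (err n mu rn mut)).
move=> Elt; have lt_tol : Dbar n (sel n) < cD * tol.
  by rewrite (le_lt_trans relE)// -Ceps ltr_pM2l.
by split=> //; exact: strict.
Qed.
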